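(* Let $\lambda\in(1,\infty)$, let $v:\widehat{\mathcal C}\to\mathbb R$ be a bounded function satisfying $$E\big[v(\widehat{\boldsymbol f}(\boldsymbol x,\boldsymbol u))\big]-\lambda\, v(\boldsymbol x)\ \ge\ 0\qquad\text{for all }\boldsymbol x\in\widehat{\mathcal C}\setminus\mathcal X_r,$$ and let $\Omega=\{\boldsymbol x\in\mathcal C\mid v(\boldsymbol x)>0\}$. Then for any $\boldsymbol x_0\in\Omega$ there exists a controller $\pi\in\mathbb U$ such that the system $\boldsymbol x(k+1)=\boldsymbol f(\boldsymbol x(k),\boldsymbol u(k))$ started at $\boldsymbol x_0$ reaches the target set $\mathcal X_r$ while staying inside the set $\Omega$ before the first target hitting time; that is, there is $k\in\mathbb N$ with $\boldsymbol\phi_{\boldsymbol x_0}^{\pi}(k)\in\mathcal X_r$ and, for the smallest such $k$, $\boldsymbol\phi_{\boldsymbol x_0}^{\pi}(l)\in\Omega$ for all $0\le l<k$.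
   Context: Consider the discrete-time control system $\boldsymbol x(k+1)=\boldsymbol f(\boldsymbol x(k),\boldsymbol u(k))$, $k\in\mathbb N=\{0,1,2,\dots\}$, with states in $\mathcal D\subseteq\mathbb R^n$, control inputs $\boldsymbol u(k)\in\mathcal U\subseteq\mathbb R^m$, and $\boldsymbol f:\mathbb R^n\times\mathbb R^m\to\mathbb R^n$ continuous. A controller is a sequence $\pi=(\boldsymbol u(l))_{l\in\mathbb N}$ with $\boldsymbol u(l)\in\mathcal U$ for all $l$; $\mathbb U$ is the set of all controllers. The trajectory $(\boldsymbol\phi_{\boldsymbol x_0}^{\pi}(l))_{l\in\mathbb N}$ induced by $\boldsymbol x_0\in\mathbb R^n$ and $\pi$ is given by $\boldsymbol\phi_{\boldsymbol x_0}^{\pi}(0)=\boldsymbol x_0$ and $\boldsymbol\phi_{\boldsymbol x_0}^{\pi}(l+1)=\boldsymbol f(\boldsymbol\phi_{\boldsymbol x_0}^{\pi}(l),\boldsymbol u(l))$. Let $\mathcal X_r\subseteq\mathbb R^n$ be a target set and $\mathcal C\subseteq\mathcal D$ a safe set. The set $\mathcal U$ is endowed with an arbitrary but fixed probability measure $P$ (so $P(\mathcal U)=1$), and $E[\cdot]$ denotes expectation with respect to $\boldsymbol u\sim P$. $\widehat{\mathcal C}\subseteq\mathbb R^n$ is a set satisfying $$\widehat{\mathcal C}\supseteq\{\boldsymbol f(\boldsymbol x_0,\boldsymbol u)\mid \boldsymbol x_0\in\mathcal C,\ \boldsymbol u\in\mathcal U\}\cup\mathcal C.$$ With $1_{\mathcal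 A}$ denoting the indicator function of $\mathcal A$ (equal to $1$ on $\mathcal A$ and $0$ otherwise), $\widehat{\boldsymbol f}$ is defined for $\boldsymbol x\in\widehat{\mathcal C}$, $\boldsymbol u\in\mathcal U$ by $$\widehat{\boldsymbol f}(\boldsymbol x,\boldsymbol u)=1_{\mathcal C\setminus\mathcal X_r}(\boldsymbol x)\cdot\boldsymbol f(\boldsymbol x,\boldsymbol u)+1_{\mathcal X_r}(\boldsymbol x)\cdot\boldsymbol x+1_{\widehat{\mathcal C}\setminus\mathcal C}(\boldsymbol x)\cdot\boldsymbol x .$$ *)

(* Defs.v *)
From HB Require Import structures.
From mathcomp Require Import all_boot all_order all_algebra.
From mathcomp Require Import all_classical all_reals all_analysis.

Set Implicit Arguments.
Unset Strict Implicit.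
Unset Printing Implicit Defensive.

Import Order.TTheory GRing.Theory Num.Theory.
Import numFieldNormedType.Exports.

Local Open Scope classical_set_scope.
Local Open Scope ring_scope.

(* Measurable types are pointed in the library, so putting a sigma-algebra on
   the subtype [U] requires a point [u0 : U].  The point plays no other role,
   and it always exists when [U] carries a probability measure. *)
Definition input_space (T : choiceType) (U : set T) (u0 : U) : Type := U.

HB.instance Definition _ (T : choiceType) (U : set T) (u0 : U) :=
  Choice.copy (input_space u0) (set_type U).
HB.instance Definition _ (T : choiceType) (U : set T) (u0 : U) :=
  isPointed.Build (input_space u0) u0.

Definition input_val (T : choiceType) (U : set T) (u0 : U)
  (u : input_space u0) : T := \val (u : U).

Definition controllers (T : Type) (U : set T) : set (nat -> T) :=
  [set pi | forall l, U (pi l)].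

Fixpoint trajectory (X T : Type) (f : X * T -> X) (x0 : X) (pi : nat -> T)
  (l : nat) : X :=
  if l is l'.+1 then f (trajectory f x0 pi l', pi l') else x0.

(* Total in [x]; only the values at [x \in hatC] are meaningful. *)
Definition fhat (R : realType) (n m : nat) (C hatC Xr : set 'rV[R]_n)
  (f : 'rV[R]_n * 'rV[R]_m -> 'rV[R]_n) (x : 'rV[R]_n) (u : 'rV[R]_m) :
  'rV[R]_n :=
  \1_(C `\` Xr) x *: f (x, u) + \1_Xr x *: x + \1_(hatC `\` C) x *: x.

(* Main.v *)
Require Import Defs.
From HB Require Import structures.
From mathcomp Require Import all_boot all_order all_algebra.
From mathcomp Require Import all_classical all_reals all_analysis.
From mathcomp Require Import lra.

(**
A state [x] of [Omega] outside [Xr] has mean successor value at least [lambda * v x].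
So for [1 < mu < lambda] some input moves [x] to a state of value at least [mu * v x].
Outside [C] the map [fhat] is the identity, and the hypothesis forces [v <= 0] there.
Hence this successor lies in [Omega] or in [Xr].
If repeating this choice never met [Xr], then [v] would grow without bound along the trajectory.
*)

Set Implicit Arguments.
Unset Strict Implicit.
Unset Printing Implicit Defensive.

Import Order.TTheory GRing.Theory Num.Theory.
Import numFieldNormedType.Exports.

Local Open Scope classical_set_scope.
Local Open Scope ring_scope.

Section expectation_bound.
Import HBNNSimple.

(* [X] need not be measurable, so monotonicity of the integral is unavailable.
   The bound is read off the definition of the integral as a difference of
   suprema over simple functions. *)
Lemma expectation_le_bound d (T : measurableType d) (R : realType)
  (P : probability T R) (X : T -> R) (c : R) :
  0 <= c -> (forall w, X w <= c) -> ('E_P[X] <= c%:E)%E.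
Proof.
move=> c0 Xc; rewrite unlock integralE.
(* The integral of the negative part is nonnegative, so dropping it only raises the value. *)
apply: (@le_trans _ _ (\int[P]_w ((EFin \o X)^\+ w))%E).
  by rewrite geeDl// oppe_le0 integral_ge0.
rewrite ge0_integralTE//; apply: ge_ereal_sup => _ [h /= hX <-].
have -> : sintegral P h = (\int[P]_w (h w)%:E)%E.
  by rewrite integral_nnsfun// patch_setT.
apply: (@le_trans _ _ (\int[P]_w cst c%:E w)%E); last first.
  by rewrite integral_cst// [X in (_ * X)%E]probability_setT mule1.
apply: ge0_le_integral => //= [w _||w _].
- by rewrite lee_fin.
- exact/measurable_realfun.measurable_EFinP.
- by rewrite (le_trans (hX w))// funeposE /= ge_max !lee_fin Xc c0.
Qed.

End expectation_bound.

Lemma fhat_in (R : realType) (n m : nat) (C hatC Xr : set 'rV[R]_n)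
  (f : 'rV[R]_n * 'rV[R]_m -> 'rV[R]_n) x u :
  C x -> ~ Xr x -> fhat C hatC Xr f x u = f (x, u).
Proof.
move=> Cx Xrx; rewrite /fhat !indicE mem_set ?memNset ?memNset//.
  by rewrite scale1r !scale0r !addr0.
by case.
Qed.

(** The assumption [~ Xr x] matters: at a point of [Xr] in [hatC] but outside [C], the last two
    indicators are both 1 and the sum is [x + x]. *)
Lemma fhat_out (R : realType) (n m : nat) (C hatC Xr : set 'rV[R]_n)
  (f : 'rV[R]_n * 'rV[R]_m -> 'rV[R]_n) x u :
  hatC x -> ~ C x -> ~ Xr x -> fhat C hatC Xr f x u = x.
Proof.
move=> hCx Cx Xrx; rewrite /fhat !indicE.
rewrite (memNset (A := C `\` Xr)) ?(memNset Xrx) ?mem_set//; last by case.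
by rewrite scale1r !scale0r !add0r.
Qed.

(** The deterministic half of the argument: each step that avoids [Xr] raises [v] by at least
    [(mu - 1) * v x0], which the bound [M] allows only finitely often. *)
Lemma bounded_orbit_hits (R : realType) (X T : Type) (f : X * T -> X)
  (v : X -> R) (A Xr : set X) (U : set T) (u0 : T) (mu M : R) :
  U u0 -> 1 < mu -> (forall x, A x -> 0 < v x <= M) ->
  (forall x, A x -> ~ Xr x -> exists2 u, U u &
     mu * v x <= v (f (x, u)) /\ (Xr (f (x, u)) \/ A (f (x, u)))) ->
  forall x0, A x0 -> exists2 pi, controllers U pi &
    exists k, [/\ Xr (trajectory f x0 pi k),
      forall l, (l < k)%N -> ~ Xr (trajectory f x0 pi l) &
      forall l, (l < k)%N -> A (trajectory f x0 pi l)].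
Proof.
move=> Uu0 mu1 vA step x0 Ax0.
(* A total feedback law [s]; [u0] is its default value where [step] does not apply. *)
have /choice[s sP] : forall x, exists u, U u /\ (A x -> ~ Xr x ->
    mu * v x <= v (f (x, u)) /\ (Xr (f (x, u)) \/ A (f (x, u)))).
  move=> x; have [[Ax nXx]|nAX] := pselect (A x /\ ~ Xr x).
    by have [u Uu ?] := step x Ax nXx; exists u.
  by exists u0; split => // Ax nXx; case: nAX.
pose y k := iter k (fun x => f (x, s x)) x0.
have yE k : trajectory f x0 (s \o y) k = y k by elim: k => //= k ->.
exists (s \o y) => [l|]; first by have [] := sP (y l).
(* A linear lower bound suffices; the invariant [v x0 <= v (y k)] keeps each increment at least
   [(mu - 1) * v x0]. *)
have growth k : (forall l, (l < k)%N -> ~ Xr (y l)) ->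
    Xr (y k) \/ [/\ A (y k), v x0 <= v (y k) &
      k%:R * ((mu - 1) * v x0) <= v (y k)].
  elim: k => [|k IH] nX.
    by right; rewrite mul0r; have /andP[/ltW] := vA _ Ax0.
  have nXk : ~ Xr (y k) by exact: nX.
  have [//|[Ak vk ak]] := IH (fun l lk => nX l (ltnW lk)).
  have [_ /(_ Ak nXk)[vS [|Ay]]] := sP (y k); [by left|right].
  rewrite -/(y k.+1) in vS Ay *; have /andP[v0 _] := vA _ Ax0.
  by split => //; [nra|rewrite -natr1; nra].
have hit : exists k, `[< Xr (y k) >].
  apply: contrapT => noX.
  have nX l : ~ Xr (y l) by move=> Xl; apply: noX; exists l; apply/asboolP.
  have /andP[v0 v0M] := vA _ Ax0.
  have d0 : 0 < (mu - 1) * v x0 by rewrite mulr_gt0// subr_gt0.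
  (* For this [k] the linear lower bound on [v (y k)] exceeds [M]. *)
  pose k := Num.bound (M / ((mu - 1) * v x0)).
  have [/nX//|[Ak _ ak]] := growth k (fun l _ => nX l).
  have /andP[_ vkM] := vA _ Ak.
  have /archi_boundP : 0 <= M / ((mu - 1) * v x0).
    by rewrite divr_ge0 ?ltW// (lt_le_trans v0).
  by rewrite ltr_pdivrMr// ltNge (le_trans ak vkM).
case: (ex_minnP hit) => k /asboolP Xk kmin.
have nX l : (l < k)%N -> ~ Xr (y l).
  by move=> lk /asboolP/kmin; rewrite leqNgt lk.
exists k; split => [|l lk|l lk]; rewrite yE//; first exact: nX.
by have [/(nX _ lk)//|[]] := growth l (fun j jl => nX j (ltn_trans jl lk)).
Qed.

Theorem corollary1 (R : realType) (n m : nat)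
  (D : set 'rV[R]_n) (U : set 'rV[R]_m)
  (f : 'rV[R]_n * 'rV[R]_m -> 'rV[R]_n) (hf : continuous f)
  (Xr C : set 'rV[R]_n) (hCD : C `<=` D)
  (u0 : U) (G : set (set (input_space u0)))
  (P : probability (g_sigma_algebraType G) R)
  (hatC : set 'rV[R]_n) (hhatC : f @` (C `*` U) `|` C `<=` hatC)
  (lambda : R) (hlambda : 1 < lambda)
  (v : 'rV[R]_n -> R) (hvbnd : [bounded v x | x in hatC])
  (hv : forall x, (hatC `\` Xr) x ->
     (0 <= 'E_P[fun u : input_space u0 => v (fhat C hatC Xr f x (input_val u))]
           - (lambda * v x)%:E)%E) :
  let Omega := [set x | C x /\ 0 < v x] in
  forall x0, Omega x0 ->
  exists2 pi, controllers U pi &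
    exists k, [/\ Xr (trajectory f x0 pi k),
      forall l, (l < k)%N -> ~ Xr (trajectory f x0 pi l) &
      forall l, (l < k)%N -> Omega (trajectory f x0 pi l)].
Proof.
move=> Omega x0 Ox0; have hatC_C x : C x -> hatC x by move=> Cx; apply: hhatC; right.
have [M M0 vM] : exists2 M, 0 < M & forall x, hatC x -> `|v x| <= M.
  by have [M M0 vM] := pinfty_ex_gt0 hvbnd; exists M => // x; exact: vM.
have vout x : hatC x -> ~ C x -> ~ Xr x -> v x <= 0.
  move=> hx Cx Xx; have := hv _ (conj hx Xx).
  under eq_fun => u do rewrite fhat_out//.
  by rewrite expectation_cst -EFinB lee_fin; nra.
(* Strictly between: [1 < mu] drives the growth, and [mu < lambda] contradicts the mean
   inequality. *)
pose mu := (1 + lambda) / 2.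
apply: (@bounded_orbit_hits _ _ _ f v Omega Xr U (\val u0) mu M _ _ _ _ x0 Ox0).
- exact: set_valP.
- by rewrite /mu; lra.
- by move=> x [Cx v0]; rewrite v0/= (le_trans (ler_norm _))// vM//; exact: hatC_C.
move=> x [Cx v0] Xx; apply: contrapT => noU.
(* An input exceeding [mu * v x] would be a valid choice: its successor has positive value, so by
   [vout] it lies in [C] or in [Xr], against [noU]. *)
have small (u : input_space u0) :
    v (fhat C hatC Xr f x (input_val u)) <= mu * v x.
  have Uu : U (input_val u) by exact: (set_valP (u : U)).
  rewrite fhat_in// leNgt; apply/negP => vu; apply: noU.
  exists (input_val u) => //; split; first exact: ltW.
  have [|nXf] := pselect (Xr (f (x, input_val u))); [by left|right].
  have vf0 : 0 < v (f (x, input_val u)) by apply: lt_trans vu; rewrite /mu; nra.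
  have hf' : hatC (f (x, input_val u)) by apply: hhatC; left; exists (x, input_val u).
  split=> //; apply: contrapT => /(vout _ hf')/(_ nXf).
  by rewrite leNgt vf0.
have mu0 : 0 <= mu * v x by rewrite /mu; nra.
have := hv _ (conj (hatC_C _ Cx) Xx).
(* Now [lambda * v x <= mu * v x] with [0 < v x], which is absurd. *)
rewrite sube_ge0// => /le_trans/(_ (expectation_le_bound P mu0 small)).
by rewrite lee_fin /mu; nra.
Qed.
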